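(* Let $\mathbb{P}\subseteq\mathbb{R}^{n_\mathrm{p}}$, $\gamma>0$, and consider the LPV state-space model $$\begin{bmatrix} x_{t+1}\\ y_t\end{bmatrix}=W(p_t)\begin{bmatrix} x_t \\ u_t \end{bmatrix}+b(p_t),\qquad W(p)=\begin{bmatrix}A(p)&B(p)\\ C(p)&D(p)\end{bmatrix},\qquad p_t\in\mathbb{P},$$ defined by the coefficient function $\psi_\theta:p\in\mathbb{P}\mapsto (W(p),b(p))$. The model satisfies the condition (there exists a symmetric matrix $\mathcal{X}\succ0$ in $\mathbb{R}^{n_\mathrm{x}\times n_\mathrm{x}}$ such that) $$\begin{bmatrix}\mathcal{X}&0\\ 0&\gamma^2 I\end{bmatrix}-W(p)^\top\begin{bmatrix}\mathcal{X}&0\\ 0&I\end{bmatrix}W(p)\succ 0\quad\text{for all }p\in\mathbb{P}$$ if and only if there exist $d\in\mathbb{R}^{n_\mathrm{x}}$, $\mathcal{Y}\in\mathbb{R}^{n_\mathrm{x}\times n_\mathrm{x}}$ and a mapping $\phi:p\mapsto(X(p),Y(p),Z(p))$ on $\mathbb{P}$ with $X(p),Y(p)\in\mathbb{R}^{n\times n}$ and $Z(p)\in\mathbb{R}^{n_0\times n}$, where $n=n_\mathrm{x}+\min(n_\mathrm{u},n_\mathrm{y})$ and $n_0=|n_\mathrm{y}-n_\mathrm{u}|$, such that, for all $p\in\mathbb{P}$, $$W(p)=\begin{bmatrix}Q\Lambda^{-1}&0\\ 0&I\end{bmatrix}M(p)\begin{bmatrix}\Lambda Q^\top&0\\ 0&\gamma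 I\end{bmatrix},$$ with $\Lambda=\mathrm{diag}(e^d)$, $Q=\mathrm{Cayley}(\mathcal{Y}-\mathcal{Y}^\top)$, and $$\begin{bmatrix}\mathrm{Cayley}(N(p))\\ -2Z(p)(I+N(p))^{-1}\end{bmatrix}=\begin{cases}M(p),&\text{if }n_\mathrm{y}\ge n_\mathrm{u},\\ M(p)^\top,&\text{if }n_\mathrm{y}<n_\mathrm{u},\end{cases}$$ where $N(p)=X(p)^\top X(p)+Y(p)-Y(p)^\top+Z(p)^\top Z(p)+\epsilon I$ with $\epsilon$ some small positive constant.
   Context: All matrices are real. For a square matrix $M$ with $I+M$ invertible, $\mathrm{Cayley}(M):=(I-M)(I+M)^{-1}$. For $d=(d_1,\dots,d_n)\in\mathbb{R}^n$, $\mathrm{diag}(e^d)$ is the diagonal matrix with diagonal entries $e^{d_1},\dots,e^{d_n}$. $S\succ 0$ means that $S$ is symmetric positive definite. The dimensions are $x_t\in\mathbb{R}^{n_\mathrm{x}}$, $u_t\in\mathbb{R}^{n_\mathrm{u}}$, $y_t\in\mathbb{R}^{n_\mathrm{y}}$, $p_t\in\mathbb{P}\subseteq\mathbb{R}^{n_\mathrm{p}}$ (state, input, output and scheduling signal); $W$ is a function on $\mathbb{P}$ with values in $\mathbb{R}^{(n_\mathrm{x}+n_\mathrm{y})\times(n_\mathrm{x}+n_\mathrm{u})}$ and $b$ a function on $\mathbb{P}$ with values in $\mathbb{R}^{n_\mathrm{x}+n_\mathrm{y}}$. When $n_\mathrm{y}=n_\mathrm{u}$, $Z(p)$ is an empty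 matrix (and $Z(p)^\top Z(p)=0$).
   Formalization: The small positive constant ε is allowed to depend on p: with one ε for all p the ''only if'' direction fails, e.g. n_x=1, n_u=n_y=1, A=B=C=0, D(p)=γp on P=(0,1), where N(p) has the eigenvalue (1-p)/(1+p), which tends to 0. *)

(* Defs.v *)
From mathcomp Require Import all_boot all_order all_algebra.
From mathcomp Require Import classical_sets reals sequences exp.

Set Implicit Arguments.
Unset Strict Implicit.
Unset Printing Implicit Defensive.

Import Order.TTheory GRing.Theory Num.Theory.
Local Open Scope ring_scope.

Definition posdefmx (R : realType) (n : nat) (S : 'M[R]_n) : Prop :=
  S^T = S /\ forall v : 'cV[R]_n, v != 0 -> 0 < (v^T *m S *m v) 0 0.

(* [invmx] is total; the value is the intended one when I + M is invertible.
   This is automatic for a skew-symmetric M, and more generally for any M with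
   positive semidefinite symmetric part. *)
Definition Cayley (R : realType) (n : nat) (M : 'M[R]_n) : 'M[R]_n :=
  (1%:M - M) *m invmx (1%:M + M).

Definition diag_exp (R : realType) (n : nat) (d : 'rV[R]_n) : 'M[R]_n :=
  diag_mx (map_mx (@expR R) d).

Definition dimn (nx nu ny : nat) : nat := (nx + minn nu ny)%N.

(* Absolute difference of natural numbers, not truncated subtraction. *)
Definition dimn0 (nu ny : nat) : nat := `|ny - nu|%N.

Lemma dimn_le (nx nu ny : nat) : (nu <= ny)%N -> dimn nx nu ny = (nx + nu)%N.
Proof. by move=> h; rewrite /dimn (minn_idPl h). Qed.

Lemma dimnD_le (nx nu ny : nat) :
  (nu <= ny)%N -> (dimn nx nu ny + dimn0 nu ny)%N = (nx + ny)%N.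
Proof. by move=> h; rewrite dimn_le // /dimn0 distnEl // -addnA subnKC. Qed.

Lemma dimn_gt (nx nu ny : nat) : (ny < nu)%N -> dimn nx nu ny = (nx + ny)%N.
Proof. by move=> h; rewrite /dimn (minn_idPr (ltnW h)). Qed.

Lemma dimnD_gt (nx nu ny : nat) :
  (ny < nu)%N -> (dimn nx nu ny + dimn0 nu ny)%N = (nx + nu)%N.
Proof.
by move=> h; rewrite dimn_gt // /dimn0 distnEr ?(ltnW h) // -addnA subnKC // ltnW.
Qed.

Definition Nmx (R : realType) (n n0 : nat) (eps : R)
    (XYZ : 'M[R]_n * 'M[R]_n * 'M[R]_(n0, n)) : 'M[R]_n :=
  let: (X, Y, Z) := XYZ in
  X^T *m X + Y - Y^T + Z^T *m Z + eps%:M.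

Definition Cayley_stack (R : realType) (n n0 : nat) (eps : R)
    (XYZ : 'M[R]_n * 'M[R]_n * 'M[R]_(n0, n)) : 'M[R]_(n + n0, n) :=
  let: (_, _, Z) := XYZ in
  let N := Nmx eps XYZ in
  col_mx (Cayley N) ((-2) *: Z *m invmx (1%:M + N)).

(* S = M if nu <= ny, and S = M^T if ny < nu; the casts only identify the
   (propositionally equal) dimensions of the two sides. *)
Definition eq_up_to_tr (R : realType) (nx nu ny : nat)
    (S : 'M[R]_(dimn nx nu ny + dimn0 nu ny, dimn nx nu ny))
    (M : 'M[R]_(nx + ny, nx + nu)) : Prop :=
  (forall h : (nu <= ny)%N, castmx (dimnD_le nx h, dimn_le nx h) S = M) /\
  (forall h : (ny < nu)%N, castmx (dimnD_gt nx h, dimn_gt nx h) S = M^T).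

(* Main.v *)
Require Import Defs.
From mathcomp Require Import all_boot all_order all_algebra.
From mathcomp Require Import boolp classical_sets reals sequences exp.
From mathcomp Require Import complex ring lra.
Import Order.TTheory GRing.Theory Num.Theory.
Local Open Scope ring_scope.

(* Factor the certificate as X = Q L^2 Q^T with L = diag(e^d). In the weighted
   coordinates M(p), the matrix inequality says exactly that M(p) is a strict
   contraction, equivalently that M(p)^T is one. A tall matrix [M1; M2] is a
   strict contraction iff, with N = Cayley(M1) and M2 = -2 Z (I + N)^-1, the
   symmetric part of N exceeds Z^T Z by a positive definite matrix: for
   v = (I + N) w, |v|^2 - |M v|^2 = 4 (<w, N w> - |Z w|^2).
   Finally, Q can be taken in the image of the Cayley transform on skew
   matrices, i.e. without eigenvalue -1, because flipping the signs of eigenvectors leaves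
   the spectral decomposition of X unchanged. *)

(** * The Euclidean inner product, definiteness and invertibility *)

Definition dot {R : realType} {n : nat} (u v : 'cV[R]_n) : R := (u^T *m v) 0 0.

Section RealMatrices.
Set Implicit Arguments.
Unset Strict Implicit.
Context {R : realType}.
Implicit Types (n m : nat).

Lemma dotE n (u v : 'cV[R]_n) : dot u v = \sum_i u i 0 * v i 0.
Proof. by rewrite /dot mxE; apply: eq_bigr => i _; rewrite mxE. Qed.

Lemma dotC n (u v : 'cV[R]_n) : dot u v = dot v u.
Proof. by rewrite !dotE; apply: eq_bigr => i _; rewrite mulrC. Qed.

Lemma dotDr n (u v w : 'cV[R]_n) : dot u (v + w) = dot u v + dot u w.
Proof. by rewrite /dot mulmxDr mxE. Qed.

Lemma dotDl n (u v w : 'cV[R]_n) : dot (v + w) u = dot v u + dot w u.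
Proof. by rewrite !(dotC _ u) dotDr. Qed.

Lemma dotZr n a (u v : 'cV[R]_n) : dot u (a *: v) = a * dot u v.
Proof. by rewrite /dot -scalemxAr mxE. Qed.

Lemma dotZl n a (u v : 'cV[R]_n) : dot (a *: u) v = a * dot u v.
Proof. by rewrite dotC dotZr dotC. Qed.

Lemma dotNr n (u v : 'cV[R]_n) : dot u (- v) = - dot u v.
Proof. by rewrite /dot mulmxN mxE. Qed.

Lemma dotNl n (u v : 'cV[R]_n) : dot (- u) v = - dot u v.
Proof. by rewrite dotC dotNr dotC. Qed.

Lemma dot_tr n m (A : 'M[R]_(m, n)) u v : dot u (A *m v) = dot (A^T *m u) v.
Proof. by rewrite /dot trmx_mul trmxK mulmxA. Qed.

Lemma dot_trl n m (A : 'M[R]_(m, n)) u v : dot u (A^T *m v) = dot (A *m u) v.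
Proof. by rewrite dot_tr trmxK. Qed.

Lemma dot_ge0 n (u : 'cV[R]_n) : 0 <= dot u u.
Proof. by rewrite dotE sumr_ge0 // => i _; rewrite -expr2 sqr_ge0. Qed.

Lemma dot_eq0 n (u : 'cV[R]_n) : (dot u u == 0) = (u == 0).
Proof.
rewrite dotE psumr_eq0 => [|i _]; last by rewrite -expr2 sqr_ge0.
apply/allP/eqP => [h|-> i _]; last by rewrite mxE mul0r eqxx.
apply/matrixP => i j; rewrite ord1 mxE.
by have := h i (mem_index_enum i); rewrite -expr2 sqrf_eq0 => /eqP.
Qed.

Lemma dot_gt0 n (u : 'cV[R]_n) : (0 < dot u u) = (u != 0).
Proof. by rewrite lt0r dot_eq0 dot_ge0 andbT. Qed.

Definition dot_bilinear := (@dotDl, @dotDr, @dotNl, @dotNr, @dotZl, @dotZr).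

Lemma dot_col_mx m1 m2 (a c : 'cV[R]_m1) (b d : 'cV[R]_m2) :
  dot (col_mx a b) (col_mx c d) = dot a c + dot b d.
Proof. by rewrite /dot tr_col_mx mul_row_col mxE. Qed.

Lemma posdefmxE n (S : 'M[R]_n) :
  posdefmx S <-> S^T = S /\ forall v, v != 0 -> 0 < dot v (S *m v).
Proof. by split=> -[? h]; split=> // v /h; rewrite /dot mulmxA. Qed.

Lemma unitmx_ker0 n (A : 'M[R]_n) :
  (forall v : 'cV_n, A *m v = 0 -> v = 0) -> A \in unitmx.
Proof.
move=> h; rewrite -unitmx_tr -row_free_unit -kermx_eq0.
apply/eqP/row_matrixP => i.
rewrite row0; apply: trmx_inj; rewrite trmx0; apply: h.
by apply: trmx_inj; rewrite trmx_mul trmxK trmx0 -row_mul mulmx_ker row0.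
Qed.

Lemma mul_unitmx_eq0 n (A : 'M[R]_n) (v : 'cV_n) :
  A \in unitmx -> (A *m v == 0) = (v == 0).
Proof.
move=> uA; apply/eqP/eqP => [h|->]; last by rewrite mulmx0.
by rewrite -(mulKmx uA v) h mulmx0.
Qed.

(** * The spectral theorem over a real field *)

(** Since [R[i]] is algebraically closed, [A] has a complex left eigenvector [z]; by symmetry it is
    also a right one. Symmetry forces the eigenvalue to be real, so whichever of the real and
    imaginary parts [x], [y] of [z] is nonzero is a real eigenvector. *)
Lemma symmetric_eigenvector n (A : 'M[R]_n.+1) : A^T = A ->
  exists a (v : 'cV[R]_n.+1), v != 0 /\ A *m v = a *: v.
Proof.
move=> symA; pose AC := map_mx (real_complex R) A.
have [a /eigenvalueP[z zE z0]] := eigenvalue_closed AC (ltn0Sn n).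
pose x := (map_mx (@complex.Re R) z)^T; pose y := (map_mx (@complex.Im R) z)^T.
have zE' j : \sum_i z 0 i * (A i j)%:C%C = a * z 0 j.
  have /matrixP /(_ 0 j) := zE; rewrite !mxE => <-.
  by apply: eq_bigr => i _; rewrite mxE.
have ReS I (F : I -> R[i]) (s : seq I) :
    complex.Re (\sum_(i <- s) F i) = \sum_(i <- s) complex.Re (F i).
  by apply: (big_morph (@complex.Re R)) => // -[? ?] [? ?].
have ImS I (F : I -> R[i]) (s : seq I) :
    complex.Im (\sum_(i <- s) F i) = \sum_(i <- s) complex.Im (F i).
  by apply: (big_morph (@complex.Im R)) => // -[? ?] [? ?].
have Ax : A *m x = complex.Re a *: x - complex.Im a *: y.
  apply/matrixP => j k; rewrite ord1 !mxE.
  have /(congr1 (@complex.Re R)) := zE' j; rewrite ReS.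
  have -> : complex.Re (a * z 0 j) =
      complex.Re a * complex.Re (z 0 j) - complex.Im a * complex.Im (z 0 j).
    by case: (a) (z 0 j) => ? ? [? ?].
  move=> <-; apply: eq_bigr => i _; rewrite !mxE -[in LHS]symA mxE.
  by case: (z 0 i) => ? ? /=; ring.
have Ay : A *m y = complex.Re a *: y + complex.Im a *: x.
  apply/matrixP => j k; rewrite ord1 !mxE.
  have /(congr1 (@complex.Im R)) := zE' j; rewrite ImS.
  have -> : complex.Im (a * z 0 j) =
      complex.Re a * complex.Im (z 0 j) + complex.Im a * complex.Re (z 0 j).
    by case: (a) (z 0 j) => ? ? [? ?].
  move=> <-; apply: eq_bigr => i _; rewrite !mxE -[in LHS]symA mxE.
  by case: (z 0 i) => ? ? /=; ring.
have xy0 : (x != 0) || (y != 0).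
  rewrite -negb_and; apply: contra z0 => /andP[/eqP x0 /eqP y0].
  apply/eqP/matrixP => i j; rewrite ord1 mxE; apply/eqP; rewrite eq_complex /=.
  have /matrixP /(_ j 0) := x0; have /matrixP /(_ j 0) := y0.
  by rewrite !mxE => -> ->; rewrite eqxx.
(* Expanding both sides of [dot y (A *m x) = dot x (A *m y)] leaves [Im a * (|x|^2 + |y|^2) = 0]. *)
have Ima0 : complex.Im a = 0.
  have : dot y (A *m x) = dot x (A *m y) by rewrite dot_tr symA dotC.
  rewrite Ax Ay !dot_bilinear (dotC y x) => h.
  have {h}/eqP : complex.Im a * (dot x x + dot y y) = 0 by lra.
  rewrite mulf_eq0 => /orP[/eqP//|].
  rewrite paddr_eq0 ?dot_ge0 // !dot_eq0 => /andP[/eqP x0 /eqP y0].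
  by move: xy0; rewrite x0 y0 eqxx.
move: Ax Ay; rewrite Ima0 !scale0r subr0 addr0 => Ax Ay.
by case/orP: xy0 => ?; exists (complex.Re a); [exists x|exists y].
Qed.

Lemma orthogonalC n (U : 'M[R]_n) : U *m U^T = 1%:M <-> U^T *m U = 1%:M.
Proof. by split=> /mulmx1C. Qed.

(** The witness is the reflection in the hyperplane orthogonal to [w = u - v]. Equal norms give
    [|w|^2 = 2 <w, u>], so the reflection subtracts exactly [w] from [u]. *)
Lemma householder n (u v : 'cV[R]_n) : dot u u = dot v v ->
  exists H : 'M[R]_n, [/\ H^T = H, H *m H = 1%:M & H *m u = v].
Proof.
move=> uv; have [->|neq] := eqVneq u v.
  by exists 1%:M; rewrite trmx1 !mul1mx.
pose w := u - v; pose c := dot w w.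
have c0 : c != 0 by rewrite dot_eq0 subr_eq0.
have cE : c = 2 * dot w u.
  rewrite /c /w !dot_bilinear uv (dotC v u); ring.
have scal (t : 'cV[R]_n) : w *m (w^T *m t) = dot w t *: w.
  by rewrite [w^T *m t]mx11_scalar mul_mx_scalar.
have wwT : (w *m w^T) *m (w *m w^T) = c *: (w *m w^T).
  by rewrite -mulmxA (mulmxA w^T) mulmxA scal -scalemxAl.
exists (1%:M - (2 / c) *: (w *m w^T)); split.
- by rewrite linearB linearZ /= trmx1 trmx_mul trmxK.
- rewrite mulmxBl mul1mx mulmxBr mulmx1 -scalemxAl -scalemxAr wwT !scalerA.
  rewrite (_ : 2 / c * (2 / c) * c = 2 / c + 2 / c); last by field.
  by rewrite scalerDl opprB addrK subrK.
- rewrite mulmxBl mul1mx -scalemxAl -mulmxA scal scalerA.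
  rewrite (_ : 2 / c * dot w u = 1) ?scale1r ?/w ?subKr //.
  by rewrite mulrAC -cE divff.
Qed.

(** Deflation: a reflection [H] carrying the first basis vector to a unit eigenvector conjugates [A]
    into a block diagonal matrix, whose lower right block is diagonalized by induction. *)
Lemma symmetric_spectral n (A : 'M[R]_n) : A^T = A ->
  exists (U : 'M[R]_n) (d : 'rV[R]_n),
    U *m U^T = 1%:M /\ A = U *m diag_mx d *m U^T.
Proof.
elim: n A => [|n IHn] A symA.
  by exists 0, 0; split; apply/matrixP => -[].
have [a [v0 [v0_neq0 Av0]]] := symmetric_eigenvector symA.
pose s := Num.sqrt (dot v0 v0).
have s0 : s != 0 by rewrite gt_eqF // sqrtr_gt0 dot_gt0.
pose v := s^-1 *: v0.
have Av : A *m v = a *: v by rewrite -scalemxAr Av0 !scalerA mulrC.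
have vv : dot v v = 1.
  rewrite !dot_bilinear -(sqr_sqrtr (dot_ge0 v0)) -/s; field; exact: s0.
pose e : 'cV[R]_(1 + n) := col_mx 1%:M 0.
have ee : dot e e = 1.
  by rewrite dot_col_mx /dot trmx1 mulmx1 mulmx0 !mxE addr0.
have [H [HT HH He]] := householder (etrans ee (esym vv)).
have Hv : H *m v = e by rewrite -He mulmxA HH mul1mx.
pose B : 'M[R]_(1 + n) := H *m A *m H.
have Be : B *m e = a *: e by rewrite /B -2!mulmxA He Av -scalemxAr Hv.
have BT : B^T = B by rewrite /B !trmx_mul HT symA mulmxA.
(* The first column of [B] is [a *: e], so its lower part vanishes; symmetry then clears the upper
   right block. *)
have dlB : dlsubmx B = 0.
  move: Be; rewrite -{1}[B]submxK mul_block_col !mulmx1 !mulmx0 !addr0.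
  by rewrite scale_col_mx scaler0 => /eq_col_mx[].
have urB : ursubmx B = 0 by rewrite -{1}BT -trmx_dlsub dlB trmx0.
have [U' [d' [U'U' dB]]] := IHn _ (etrans (trmx_drsub B) (congr1 drsubmx BT)).
pose G : 'M[R]_(1 + n) := block_mx 1%:M 0 0 U'.
have GG : G *m G^T = 1%:M.
  rewrite /G tr_block_mx mulmx_block.
  rewrite !(mulmx0, mul0mx, trmx0, trmx1, mulmx1, mul1mx, add0r, addr0) U'U'.
  by rewrite -scalar_mx_block.
have BE : B = G *m diag_mx (row_mx (ulsubmx B) d') *m G^T.
  rewrite /G diag_mx_row tr_block_mx !mulmx_block.
  rewrite !(mulmx0, mul0mx, trmx0, trmx1, mulmx1, mul1mx, add0r, addr0) -dB.
  rewrite -{1}[B]submxK dlB urB; congr block_mx.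
  by apply/matrixP => i j; rewrite !ord1 !mxE eqxx.
exists (H *m G), (row_mx (ulsubmx B) d'); split.
  by rewrite trmx_mul HT mulmxA -(mulmxA H) GG mulmx1.
rewrite trmx_mul HT !mulmxA -2!(mulmxA H) -BE /B.
by rewrite -!mulmxA HH mulmx1 mulmxA HH mul1mx.
Qed.

Lemma posdef_spectral n (S : 'M[R]_n) : posdefmx S ->
  exists (U : 'M[R]_n) (d : 'rV[R]_n),
    [/\ U *m U^T = 1%:M, S = U *m diag_mx d *m U^T & forall i, 0 < d 0 i].
Proof.
move=> /posdefmxE[/symmetric_spectral[U [d [UU SE]]] Spos].
exists U, d; split=> // i; have U'U := (orthogonalC U).1 UU.
(* The quadratic form at the [i]-th column of [U] equals [d 0 i]. *)
have u0 : U *m delta_mx i (0 : 'I_1) != 0.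
  rewrite mul_unitmx_eq0; last by case/mulmx1_unit: UU.
  apply/eqP => /matrixP /(_ i 0); rewrite !mxE !eqxx => /eqP.
  by rewrite oner_eq0.
have := Spos _ u0; rewrite SE -!mulmxA (mulmxA U^T) U'U mul1mx.
rewrite dot_tr mulmxA U'U mul1mx -colE dotE (bigD1 i) //= big1 => [|j ji].
  by rewrite !mxE !eqxx mul1r mulr1n addr0.
by rewrite !mxE (negPf ji) mul0r.
Qed.

Lemma posdef_shifted_square n (S : 'M[R]_n) : posdefmx S ->
  exists2 eps : R, 0 < eps & exists X : 'M[R]_n, S = X^T *m X + eps%:M.
Proof.
case/posdef_spectral=> U [d [UU SE dpos]].
(* The least eigenvalue, capped at [1] so that it is positive even for [n = 0]; [S - eps%:M] stays
   positive semidefinite and has a square root. *)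
pose eps := \big[Order.min/1]_i d 0 i.
exists eps; first by apply: lt_bigmin; rewrite ?ltr01.
exists (diag_mx (\row_i Num.sqrt (d 0 i - eps)) *m U^T).
rewrite trmx_mul trmxK tr_diag_mx mulmxA -(mulmxA U) mulmx_diag.
rewrite -[eps%:M]mulmx1 -UU mulmxA -scalar_mxC -!mulmxA -mulmxDr SE -mulmxA.
rewrite -mulmxDl -diag_const_mx -linearD; congr (_ *m (diag_mx _ *m _)).
apply/rowP => i; rewrite !mxE -expr2 sqr_sqrtr ?subrK //.
by rewrite subr_ge0 bigmin_le_cond.
Qed.

(* The determinant is affine in each diagonal entry, and its slope is the
   complementary minor, which is nonzero by induction: so it cannot vanish for
   both choices of the sign. *)
Lemma sign_diag_unitmx n (A : 'M[R]_n) :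
  exists s : 'rV[R]_n,
    (forall i, s 0 i * s 0 i = 1) /\ A + diag_mx s \in unitmx.
Proof.
elim: n A => [|n IHn] A.
  by exists 0; split=> [[]//|]; rewrite unitmxE det_mx00 unitr1.
have [s [s1]] := IHn (drsubmx (A : 'M_(1 + n))); rewrite unitmxE unitfE => sU.
pose A1 : 'M_(1 + n) := A.
pose M t : 'M[R]_(1 + n) := A1 + diag_mx (row_mx t%:M s).
have rs1 (t : R) : t * t = 1 ->
    forall i, row_mx t%:M s 0 i * row_mx t%:M s 0 i = 1.
  by move=> t1 i; rewrite mxE; case: splitP => j _ //; rewrite ord1 !mxE mulr1n.
have ME t : M t = block_mx (ulsubmx A1 + t%:M) (ursubmx A1)
                           (dlsubmx A1) (drsubmx A1 + diag_mx s).
  rewrite /M -{1}[A1]submxK diag_mx_row add_block_mx !addr0.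
  by congr (block_mx (_ + _) _ _ _); apply/matrixP => i j; rewrite !ord1 !mxE.
pose C := block_mx 1%:M 0 (dlsubmx A1) (drsubmx A1 + diag_mx s).
have detM : \det (M 1) = 1 * \det (M (-1)) + 2 * \det C.
  apply: (@determinant_multilinear _ _ _ _ _ 0).
  - apply/rowP => j; rewrite !ME /C !mxE; case: splitP => i //; rewrite !ord1.
    by rewrite !mxE; case: splitP => k _;
      rewrite !mxE ?ord1 ?eqxx // => _; ring.
  - apply/matrixP => i j; rewrite !ME !mxE; case: splitP => // k.
    by rewrite !ord1.
  - apply/matrixP => i j; rewrite !ME !mxE; case: splitP => // k.
    by rewrite !ord1.
have [M1|M1] := eqVneq (\det (M 1)) 0; last first.
  exists (row_mx 1%:M s); split; first by apply: rs1; rewrite mulr1.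
  by rewrite unitmxE unitfE.
exists (row_mx (-1)%:M s); split; first by apply: rs1; rewrite mulrNN mulr1.
rewrite unitmxE unitfE; apply/negP => /eqP; rewrite -/(M (-1)) => M2.
move/eqP: detM; rewrite M1 M2 mulr0 add0r eq_sym mulf_eq0 pnatr_eq0 /=.
by rewrite det_lblock det1 mul1r (negPf sU).
Qed.

(** * The Cayley transform *)

(** Pairing [(1 + N) v = 0] with [v] gives [|v|^2 + <v, N v> = 0], a sum of nonnegative terms. *)
Lemma unitmx_addmx1 n (N : 'M[R]_n) :
  (forall v, 0 <= dot v (N *m v)) -> 1%:M + N \in unitmx.
Proof.
move=> N0; apply: unitmx_ker0 => v; rewrite mulmxDl mul1mx => h.
have := congr1 (dot v) h; rewrite dotDr {3}/dot mulmx0 mxE => /eqP.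
by rewrite paddr_eq0 ?dot_ge0 // dot_eq0 => /andP[/eqP].
Qed.

Lemma dot_skew n (K : 'M[R]_n) v : K^T = - K -> dot v (K *m v) = 0.
Proof.
move=> KT; have := dot_tr K v v.
rewrite KT mulNmx dotNl dotC => /eqP; rewrite dotC.
by rewrite -addr_eq0 -mulr2n mulrn_eq0 /= => /eqP.
Qed.

Lemma unitmx_addmx1_skew n (K : 'M[R]_n) : K^T = - K -> 1%:M + K \in unitmx.
Proof. by move=> KT; apply: unitmx_addmx1 => v; rewrite dot_skew. Qed.

Lemma CayleyM n (M : 'M[R]_n) : 1%:M + M \in unitmx ->
  Cayley M *m (1%:M + M) = 1%:M - M.
Proof. by move=> uM; rewrite mulmxKV. Qed.

(** Indeed [1 + Cayley M = 2 (1 + M)^-1]. *)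
Lemma unitmx_addmx1_Cayley n (M : 'M[R]_n) :
  1%:M + M \in unitmx -> 1%:M + Cayley M \in unitmx.
Proof.
move=> uM; have : (1%:M + Cayley M) *m (2^-1 *: (1%:M + M)) = 1%:M.
  rewrite -scalemxAr mulmxDl mul1mx CayleyM // addrACA subrr addr0.
  by rewrite -mulr2n -scaler_nat scalerA mulVf ?scale1r ?pnatr_eq0.
by case/mulmx1_unit.
Qed.

Lemma CayleyK n (M : 'M[R]_n) : 1%:M + M \in unitmx -> Cayley (Cayley M) = M.
Proof.
move=> uM; have uC := unitmx_addmx1_Cayley uM.
apply: (can_inj (mulmxK uC)); rewrite CayleyM //.
apply: (can_inj (mulmxK uM)); rewrite -mulmxA mulmxBl mulmxDl mul1mx CayleyM //.
rewrite opprB addrC addrA subrK addrACA subrr addr0.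
by rewrite mulmxDr mulmx1.
Qed.

(** [1 + K] and [1 - K] are transposes of each other and commute, so all factors of the product
    cancel. *)
Lemma Cayley_skew_orthogonal n (K : 'M[R]_n) : K^T = - K ->
  (Cayley K)^T *m Cayley K = 1%:M.
Proof.
move=> KT; have uK := unitmx_addmx1_skew KT.
have tD : (1%:M + K)^T = 1%:M - K by rewrite linearD /= trmx1 KT.
have tB : (1%:M - K)^T = 1%:M + K by rewrite linearB /= trmx1 KT opprK.
have uK' : 1%:M - K \in unitmx by rewrite -tD unitmx_tr.
have comm : (1%:M + K) *m (1%:M - K) = (1%:M - K) *m (1%:M + K).
  rewrite mulmxDl mulmxBl !mulmxDr !mul1mx !mulmx1 !mulmxN.
  by rewrite addrA subrK opprD addrA addrK.
rewrite /Cayley trmx_mul trmx_inv tD tB mulmxA -(mulmxA (invmx _)) comm.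
by rewrite mulmxA mulVmx // mul1mx mulmxV.
Qed.

(** Clearing the inverses [(1 + Q^T)^-1] and [(1 + Q)^-1] leaves
    [(1 - Q^T)(1 + Q) = - (1 + Q^T)(1 - Q)]; by orthogonality both sides equal [Q - Q^T]. *)
Lemma Cayley_orthogonal_skew n (Q : 'M[R]_n) : Q^T *m Q = 1%:M ->
  1%:M + Q \in unitmx -> (Cayley Q)^T = - Cayley Q.
Proof.
move=> QQ uQ; have tD : (1%:M + Q)^T = 1%:M + Q^T by rewrite linearD /= trmx1.
have tB : (1%:M - Q)^T = 1%:M - Q^T by rewrite linearB /= trmx1.
have uQT : 1%:M + Q^T \in unitmx by rewrite -tD unitmx_tr.
apply: (can_inj (mulmxK uQ)); rewrite mulNmx CayleyM //.
apply: (can_inj (mulKmx uQT)).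
rewrite trmx_mul trmx_inv tD tB -mulmxA mulKVmx // mulmxN.
rewrite mulmxBl mulmxDl !mulmxDr !mul1mx !mulmx1 mulmxN QQ.
rewrite [RHS]opprD !opprB addrA subrK (addrC _ Q) opprD addrACA subrr.
by rewrite addr0.
Qed.

(** * Strict contractions and the Cayley parametrization *)

Definition contractive m n (M : 'M[R]_(m, n)) : Prop :=
  forall v, v != 0 -> dot (M *m v) (M *m v) < dot v v.

(** With [w = M^T v], expand [0 <= |v - M w|^2 = |v|^2 - 2 |w|^2 + |M w|^2] and use
    [|M w|^2 < |w|^2] when [w] is nonzero. *)
Lemma contractive_tr m n (M : 'M[R]_(m, n)) : contractive M -> contractive M^T.
Proof.
move=> cM v v0; have [->|w0] := eqVneq (M^T *m v) 0.
  by rewrite {1}/dot mulmx0 mxE dot_gt0.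
have := dot_ge0 (v - M *m (M^T *m v)); have := cM _ w0.
rewrite !dot_bilinear (dotC _ v) (dot_tr M v); lra.
Qed.

Lemma posdef_contractive m n (M : 'M[R]_(m, n)) (T : 'M[R]_n) :
  T \in unitmx ->
  posdefmx (T^T *m T - (M *m T)^T *m (M *m T)) <-> contractive M.
Proof.
move=> uT; set S := _ - _.
have SE v : dot v (S *m v) =
    dot (T *m v) (T *m v) - dot (M *m (T *m v)) (M *m (T *m v)).
  by rewrite mulmxBl !dot_bilinear -!mulmxA !dot_trl -!mulmxA.
split=> [/posdefmxE[_ Spos] v v0|cM].
  have := Spos (invmx T *m v); rewrite SE mulKVmx // subr_gt0; apply.
  by rewrite mul_unitmx_eq0 // unitmx_inv.
apply/posdefmxE; split; first by rewrite /S linearB /= !trmx_mul !trmxK.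
by move=> v v0; rewrite SE subr_gt0; apply: cM; rewrite mul_unitmx_eq0.
Qed.

Lemma dot_Nmx n n0 (eps : R) (X Y : 'M[R]_n) (Z : 'M[R]_(n0, n)) v :
  dot v (Nmx eps (X, Y, Z) *m v) =
  dot (X *m v) (X *m v) + dot (Z *m v) (Z *m v) + eps * dot v v.
Proof.
rewrite /Nmx !mulmxDl mulNmx mul_scalar_mx !dot_bilinear -!mulmxA !dot_trl.
by rewrite (dotC (Y *m v)) addrK.
Qed.

(** For [v = (1 + N) w] the image is [(w - N w, -2 Z w)], so the loss of squared norm is
    [4 (|X w|^2 + eps |w|^2)]. *)
Lemma Cayley_stack_contractive n n0 (eps : R) XYZ : 0 < eps ->
  contractive (Cayley_stack eps XYZ : 'M[R]_(n + n0, n)).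
Proof.
case: XYZ => [[X Y] Z] e0 v v0; rewrite /Cayley_stack.
move: (Nmx eps _) (dot_Nmx eps X Y Z) => N NE.
have uN : 1%:M + N \in unitmx.
  apply: unitmx_addmx1 => u.
  by rewrite NE !addr_ge0 ?dot_ge0 // mulr_ge0 ?dot_ge0 // ltW.
have [w w0 vE] : exists2 w, w != 0 & v = (1%:M + N) *m w.
  exists (invmx (1%:M + N) *m v); rewrite ?mulKVmx //.
  by rewrite mul_unitmx_eq0 ?unitmx_inv.
rewrite vE mul_col_mx mulmxA CayleyM // mulmxA mulmxKV // dot_col_mx.
rewrite !(mulmxDl, mulNmx, mul1mx) -!scalemxAl !dot_bilinear (dotC (N *m w)) NE.
have := dot_ge0 (X *m w).
have : 0 < eps * dot w w by rewrite mulr_gt0 ?dot_gt0.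
lra.
Qed.

Lemma contractive_Cayley_stack n n0 (M : 'M[R]_(n + n0, n)) : contractive M ->
  exists2 eps : R, 0 < eps & exists XYZ, Cayley_stack eps XYZ = M.
Proof.
move=> cM; pose M1 := usubmx M; pose M2 := dsubmx M.
have cM' v : v != 0 ->
    dot (M1 *m v) (M1 *m v) + dot (M2 *m v) (M2 *m v) < dot v v.
  by move=> /cM; rewrite -{1 2}[M]vsubmxK mul_col_mx dot_col_mx.
(* A kernel vector would satisfy [M1 v = - v], so [M] would not shrink it. *)
have uM1 : 1%:M + M1 \in unitmx.
  apply: unitmx_ker0 => v; rewrite mulmxDl mul1mx => /eqP.
  rewrite addrC addr_eq0 => /eqP M1v; apply/eqP; apply: contraT => /cM'.
  by rewrite M1v !dot_bilinear opprK ltNge lerDl dot_ge0.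
move: (Cayley M1) (CayleyK uM1) (unitmx_addmx1_Cayley uM1) => N M1E uN.
have [Z ZE] : exists Z, M2 *m (1%:M + N) = - 2 *: Z.
  exists (- 2^-1 *: (M2 *m (1%:M + N))).
  by rewrite scalerA mulrNN mulfV ?pnatr_eq0 // scale1r.
pose S := 2^-1 *: (N + N^T) - Z^T *m Z.
have /posdef_shifted_square[eps e0 [X SE]] : posdefmx S.
  apply/posdefmxE; split.
    rewrite /S linearB linearZ linearD /= trmx_mul !trmxK.
    by rewrite [N + _]addrC.
  move=> w w0.
  have v0 : (1%:M + N) *m w != 0 by rewrite mul_unitmx_eq0.
  have := cM' _ v0.
  have -> : M1 *m ((1%:M + N) *m w) = w - N *m w.
    by rewrite mulmxA -M1E CayleyM // mulmxBl mul1mx.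
  have -> : M2 *m ((1%:M + N) *m w) = - 2 *: (Z *m w).
    by rewrite scalemxAl -ZE mulmxA.
  rewrite /S !(mulmxDl, mulNmx, mul1mx) -!scalemxAl mulmxDl.
  rewrite !dot_bilinear -mulmxA !dot_trl (dotC (N *m w)); lra.
(* With [Y = N / 2], the term [Y - Y^T] is the skew part of [N], while [S + Z^T Z] is its symmetric
   part. *)
exists eps => //; exists (X, 2^-1 *: N, Z); rewrite /Cayley_stack.
have -> : Nmx eps (X, 2^-1 *: N, Z) = N.
  rewrite /Nmx.
  have -> : X^T *m X = S - eps%:M by rewrite SE addrK.
  rewrite /S linearZ /= scalerDr.
  apply/matrixP => i j; rewrite !mxE; lra.
rewrite -[RHS]vsubmxK; congr col_mx; first exact: M1E.
by rewrite -ZE mulmxK.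
Qed.

Lemma castmx_contractive m n m' n' (e : (m = m') * (n = n'))
    (M : 'M[R]_(m, n)) :
  contractive (castmx e M) <-> contractive M.
Proof. by case: e => em en; subst m' n'. Qed.

Lemma contractive_castmx_Cayley_stack n n0 m k (e : (n + n0 = m)%N * (n = k))
    (M : 'M[R]_(m, k)) :
  contractive M ->
  exists XYZ, exists2 eps : R, 0 < eps & castmx e (Cayley_stack eps XYZ) = M.
Proof.
case: e => em en; subst m k.
by case/contractive_Cayley_stack=> eps e0 [XYZ SE]; exists XYZ, eps.
Qed.

(** The stack has at least as many rows as columns, so a wide [M] is treated through its transpose,
    which is contractive exactly when [M] is. *)
Lemma eq_up_to_tr_contractive nx nu ny (M : 'M[R]_(nx + ny, nx + nu)) :
  contractive M <->
  exists XYZ, exists2 eps : R, 0 < eps &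
    @eq_up_to_tr R nx nu ny (Cayley_stack eps XYZ) M.
Proof.
split=> [cM|[XYZ [eps e0 [hle hgt]]]].
  case: (leqP nu ny) => h.
    have [XYZ [eps e0 SE]] :=
      contractive_castmx_Cayley_stack (dimnD_le nx h, dimn_le nx h) cM.
    have nh : ~ (ny < nu)%N by rewrite ltnNge h.
    exists XYZ, eps => //; split=> h'; last by case: (nh h').
    by rewrite (bool_irrelevance h' h).
  have [XYZ [eps e0 SE]] := contractive_castmx_Cayley_stack
    (dimnD_gt nx h, dimn_gt nx h) (contractive_tr cM).
  have nh : ~ (nu <= ny)%N by rewrite leqNgt h.
  exists XYZ, eps => //; split=> h'; first by case: (nh h').
  by rewrite (bool_irrelevance h' h).
have cS := Cayley_stack_contractive XYZ e0.
case: (leqP nu ny) => h; first by rewrite -(hle h); apply/castmx_contractive.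
rewrite -[M]trmxK; apply: contractive_tr; rewrite -(hgt h).
exact/castmx_contractive.
Qed.

(** * Weighted coordinates and the factorization of the certificate *)

Lemma diag_exp_unitmx n (d : 'rV[R]_n) : diag_exp d \in unitmx.
Proof.
rewrite unitmxE det_diag unitfE prodf_seq_neq0; apply/allP => i _ /=.
by rewrite mxE gt_eqF ?expR_gt0.
Qed.

(* The weights are [T1 = diag(Q L^-1, I)] and [T2 = diag(L Q^T, gamma I)]: they
   satisfy [T1^T diag(X, I) T1 = I] and [T2^T T2 = diag(X, gamma^2 I)] for
   [X = Q L^2 Q^T]. *)
Lemma weighted_posdef_contractive nx nu ny (gamma : R) (Q L : 'M[R]_nx)
    (M : 'M[R]_(nx + ny, nx + nu)) :
  0 < gamma -> Q^T *m Q = 1%:M -> L \in unitmx -> L^T = L ->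
  let X := Q *m L *m L *m Q^T in
  let W := block_mx (Q *m invmx L) 0 0 1%:M *m M
           *m block_mx (L *m Q^T) 0 0 gamma%:M in
  posdefmx (block_mx X 0 0 (gamma ^+ 2)%:M
            - W^T *m block_mx X 0 0 1%:M *m W) <-> contractive M.
Proof.
move=> g0 QQ uL LT X; set T1 : 'M_(nx + ny) := block_mx _ 0 0 _.
set T2 : 'M_(nx + nu) := block_mx _ 0 0 _ => W.
have QQ' := (orthogonalC Q).2 QQ.
have uT2 : T2 \in unitmx.
  have uQ : Q \in unitmx by case/mulmx1_unit: QQ.
  rewrite unitmxE det_ublock det_scalar unitrM -unitmxE unitmx_mul unitmx_tr.
  by rewrite uL uQ unitrX // unitfE gt_eqF.
have T1E : T1^T *m block_mx X 0 0 1%:M *m T1 = 1%:M.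
  rewrite /T1 tr_block_mx !mulmx_block.
  rewrite !(mulmx0, mul0mx, trmx0, trmx1, mulmx1, mul1mx, add0r, addr0).
  rewrite trmx_mul trmx_inv LT /X !mulmxA -!(mulmxA _ Q^T Q) QQ !mulmx1.
  rewrite mulVmx // mul1mx mulmxV //.
  by rewrite -scalar_mx_block.
have T2E : T2^T *m T2 = block_mx X 0 0 (gamma ^+ 2)%:M.
  rewrite /T2 tr_block_mx !mulmx_block.
  rewrite !(mulmx0, mul0mx, trmx0, trmx1, mulmx1, mul1mx, add0r, addr0).
  by rewrite trmx_mul trmxK LT !mulmxA tr_scalar_mx -scalar_mxM expr2.
have -> : W^T *m block_mx X 0 0 1%:M *m W = (M *m T2)^T *m (M *m T2).
  rewrite /W -(mulmxA T1) [(T1 *m _)^T]trmx_mul !mulmxA.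
  by rewrite -!(mulmxA (M *m T2)^T) T1E mul1mx.
by rewrite -T2E; apply: posdef_contractive.
Qed.

(** The weights are invertible, so the bracketed matrix can serve as [M p] for any given [W p]. *)
Lemma weightsK nx nu ny (gamma : R) (Q L : 'M[R]_nx)
    (W : 'M[R]_(nx + ny, nx + nu)) :
  gamma != 0 -> Q *m Q^T = 1%:M -> L \in unitmx ->
  W = block_mx (Q *m invmx L) 0 0 1%:M
      *m (block_mx (L *m Q^T) 0 0 1%:M *m W
          *m block_mx (Q *m invmx L) 0 0 (gamma^-1)%:M)
      *m block_mx (L *m Q^T) 0 0 gamma%:M.
Proof.
move=> g0 QQ uL; rewrite !mulmxA mulmx_block -mulmxA mulmx_block.
rewrite !(mulmx0, mul0mx, mulmx1, mul1mx, add0r, addr0).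
rewrite -scalar_mxM mulVf // -!mulmxA !(mulKmx uL) QQ.
by rewrite -!scalar_mx_block mul1mx mulmx1.
Qed.

Lemma posdef_Cayley_exp n (X : 'M[R]_n) : posdefmx X ->
  exists (d : 'rV[R]_n) (Y : 'M[R]_n),
    let Q := Cayley (Y - Y^T) in X = Q *m diag_exp d *m diag_exp d *m Q^T.
Proof.
case/posdef_spectral=> U [d [UU XE dpos]].
have [s [s1 uUs]] := sign_diag_unitmx U^T.
pose D := diag_mx s; pose Q := U *m D.
have DD : D *m D = 1%:M.
  rewrite mulmx_diag -diag_const_mx; congr diag_mx.
  by apply/rowP => i; rewrite !mxE.
have DT : D^T = D by rewrite tr_diag_mx.
have QQ : Q^T *m Q = 1%:M.
  by apply/orthogonalC; rewrite trmx_mul DT mulmxA -(mulmxA U) DD mulmx1.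
have uQ : 1%:M + Q \in unitmx.
  (* This factorization is why the signs were chosen for [U^T] rather than for [U]. *)
  have -> : 1%:M + Q = U *m (U^T + D) by rewrite mulmxDr UU.
  by rewrite unitmx_mul uUs andbT; case/mulmx1_unit: UU.
(* The logarithm is halved because [diag_exp] enters twice; [K] is halved because [K] is skew, which
   makes [Y - Y^T = K]. *)
pose K := Cayley Q; exists (\row_i (ln (d 0 i) / 2)), (2^-1 *: K) => /=.
have -> : 2^-1 *: K - (2^-1 *: K)^T = K.
  rewrite linearZ /= Cayley_orthogonal_skew // scalerN opprK -scalerDl.
  by rewrite (_ : 2^-1 + 2^-1 = 1) ?scale1r //; field.
set E := diag_exp _; have dE : D *m (E *m E) *m D = diag_mx d.
  rewrite !mulmx_diag; congr diag_mx; apply/rowP => i; rewrite !mxE -expRD.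
  by rewrite mulrAC s1 mul1r -splitr lnK //; exact: dpos.
by rewrite CayleyK // XE -dE /Q trmx_mul DT !mulmxA.
Qed.

End RealMatrices.


Theorem theorem2 (R : realType) (np nx nu ny : nat) (P : set 'cV[R]_np)
    (gamma : R)
    (psi : 'cV[R]_np -> 'M[R]_(nx + ny, nx + nu) * 'cV[R]_(nx + ny)) :
  0 < gamma ->
  let W p := (psi p).1 in
  let n := dimn nx nu ny in
  let n0 := dimn0 nu ny in
  (exists2 X : 'M[R]_nx, posdefmx X &
     forall p, P p ->
       posdefmx (block_mx X 0 0 (gamma ^+ 2)%:M
                 - (W p)^T *m block_mx X 0 0 1%:M *m W p))
  <->
  (exists (d : 'rV[R]_nx) (Y : 'M[R]_nx)
          (phi : 'cV[R]_np -> 'M[R]_n * 'M[R]_n * 'M[R]_(n0, n))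
          (M : 'cV[R]_np -> 'M[R]_(nx + ny, nx + nu)),
     let L := diag_exp d in
     let Q := Cayley (Y - Y^T) in
     forall p, P p ->
       W p = block_mx (Q *m invmx L) 0 0 1%:M *m M p
             *m block_mx (L *m Q^T) 0 0 gamma%:M
       /\ exists2 eps : R, 0 < eps &
            eq_up_to_tr (Cayley_stack eps (phi p)) (M p)).
Proof.
move=> g0 W n n0.
have Qorth (Y : 'M[R]_nx) : (Cayley (Y - Y^T))^T *m Cayley (Y - Y^T) = 1%:M.
  by apply: Cayley_skew_orthogonal; rewrite linearB /= trmxK opprB.
have LT (d : 'rV[R]_nx) : (diag_exp d)^T = diag_exp d by rewrite tr_diag_mx.
split=> [[X /posdef_Cayley_exp[d [Y XE]] Wpos]|[d [Y [phi [M WM]]]]].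
  set Q := Cayley _ in XE; set L := diag_exp d in XE.
  have uL : L \in unitmx := diag_exp_unitmx d.
  have QQ : Q^T *m Q = 1%:M := Qorth Y.
  pose M p : 'M[R]_(nx + ny, nx + nu) :=
    block_mx (L *m Q^T) 0 0 1%:M *m W p
    *m block_mx (Q *m invmx L) 0 0 (gamma^-1)%:M.
  have WE p : W p = block_mx (Q *m invmx L) 0 0 1%:M *m M p
                    *m block_mx (L *m Q^T) 0 0 gamma%:M.
    by apply: weightsK; rewrite ?gt_eqF //; apply/orthogonalC.
  (* The triples are found pointwise and collected by choice; outside [P] the value is the default
     [0]. The constant [eps] may depend on [p]. *)
  have phiP p : exists XYZ : 'M[R]_n * 'M[R]_n * 'M[R]_(n0, n), P p ->
      exists2 eps : R, 0 < eps & eq_up_to_tr (Cayley_stack eps XYZ) (M p).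
    have [Pp|nPp] := pselect (P p); last by exists 0.
    have /eq_up_to_tr_contractive[XYZ ?] : contractive (M p);
      last by exists XYZ.
    apply/(weighted_posdef_contractive (M p) g0 QQ uL (LT d)).
    by rewrite -WE -XE; apply: Wpos.
  have [phi phiE] := choice phiP.
  by exists d, Y, phi, M => L' Q' p Pp; split; [exact: WE|exact: phiE].
pose Q := Cayley (Y - Y^T); pose L := diag_exp d.
have uL : L \in unitmx := diag_exp_unitmx d.
(* This certificate is the Gram matrix of the invertible [L *m Q^T], hence positive definite. *)
exists (Q *m L *m L *m Q^T).
  have -> : Q *m L *m L *m Q^T = (L *m Q^T)^T *m (L *m Q^T)
    by rewrite [in RHS]trmx_mul trmxK LT !mulmxA.
  have uLQ : L *m Q^T \in unitmx.
    by rewrite unitmx_mul uL; case/mulmx1_unit: (Qorth Y).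
  apply/posdefmxE; split; first by rewrite !trmx_mul !trmxK.
  by move=> v v0; rewrite -mulmxA dot_trl dot_gt0 mul_unitmx_eq0.
move=> p Pp; have [-> [eps e0 phiM]] := WM p Pp.
apply/(weighted_posdef_contractive (M p) g0 (Qorth Y) uL (LT d)).
by apply/eq_up_to_tr_contractive; exists (phi p), eps.
Qed.
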